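(* Let $n \ge 1$ and $m \ge 1$ be integers. For $1 \le i \le m$ and $1 \le j \le n$ let $a_{ij} \le b_{ij}$ be integers, let $$K_i = \prod_{j=1}^n [a_{ij}, b_{ij}]_{\mathbb{Z}} \subset \mathbb{Z}^n, \qquad A_i = \prod_{j=1}^n \{a_{ij}, b_{ij}\},$$ and let $X = \bigcup_{i=1}^m K_i$. Suppose $X$ is $c_1$-connected. Let $A = \bigcup_{i=1}^m A_i$. Then $A$ is a freezing set for $(X, c_1)$.
   Context: For integers $a \le b$, $[a,b]_{\mathbb{Z}} = \{z \in \mathbb{Z} : a \le z \le b\}$. For $X \subset \mathbb{Z}^n$, distinct points $x,y \in X$ are $c_1$-adjacent if they differ by exactly $1$ in exactly one coordinate and agree in all other coordinates. $(X,c_1)$ is the graph with vertex set $X$ and edges given by $c_1$-adjacency; $X$ is $c_1$-connected if this graph is connected. A function $f: X \to X$ is $c_1$-continuous if it sends $c_1$-connected subsets to $c_1$-connected subsets; equivalently, whenever $x,y\in X$ are $c_1$-adjacent, $f(x)$ and $f(y)$ are $c_1$-adjacent or equal. $C(X,c_1)$ is the set of $c_1$-continuous functions $X \to X$, and $\mathrm{Fix}(f) = \{x \in X : f(x) = x\}$. A set $A \subset X$ is a freezing set for $(X,c_1)$ if for every $g \in C(X,c_1)$, $A \subset \mathrm{Fix}(g)$ implies $g = \mathrm{id}_X$. *)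

(* Defs.v *)
From mathcomp Require Import all_boot all_order all_algebra.
From mathcomp Require Import classical_sets.

Set Implicit Arguments.
Unset Strict Implicit.
Unset Printing Implicit Defensive.

Import Order.TTheory GRing.Theory Num.Theory.

Local Open Scope classical_set_scope.
Local Open Scope ring_scope.

Notation Zpt n := {ffun 'I_n -> int}.

Definition c1_adj {n} (x y : Zpt n) : bool :=
  [exists i, (`|x i - y i| == 1) && [forall j, (j != i) ==> (x j == y j)]].

(* The empty set counts as connected; this does not affect [c1_continuous],
   since the image of a set is empty only if the set is. *)
Definition c1_connected {n} (S : set (Zpt n)) : Prop :=
  forall x y, S x -> S y ->
    exists p : seq (Zpt n),
      [/\ path c1_adj x p, last x p = y & forall z, z \in p -> S z].

(* [X] in type position is the subtype [{x | x \in X}], so that [f] is a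
   genuine self-map of [X] and [S] a subset of [X]. *)
Definition c1_continuous {n} (X : set (Zpt n)) (f : X -> X) : Prop :=
  forall S : set X, c1_connected (val @` S) -> c1_connected (val @` (f @` S)).

Definition Fix {n} (X : set (Zpt n)) (f : X -> X) : set (Zpt n) :=
  val @` [set x : X | f x = x].

Definition freezing_set {n} (X A : set (Zpt n)) : Prop :=
  A `<=` X /\
  forall g : X -> X, c1_continuous g -> A `<=` Fix g -> g = id.

Definition box {n} (a b : 'I_n -> int) : set (Zpt n) :=
  [set x | forall j, a j <= x j <= b j].

Definition box_corners {n} (a b : 'I_n -> int) : set (Zpt n) :=
  [set x | forall j, x j = a j \/ x j = b j].

(* Main.v *)
(** A c1-continuous map [g] cannot increase the l1 distance between two points
    of a box contained in [X], since a box contains a geodesic between any two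
    of its points.  Let [x] lie in a box with corners fixed by [g].  Take two
    corners of the box that agree with [a] in coordinate [j] and are opposite in
    every other coordinate: the sum of the l1 distances from a point [y] to them
    is at least the sum over [k <> j] of [b k - a k] plus [2 |y j - a j|], with
    equality for [y] in the box.  Comparing [y = g x] with [y = x] yields
    [g x j <= x j]; the face [b j] yields the reverse inequality. *)

Require Import Defs.
From mathcomp Require Import all_boot all_order all_algebra.
From mathcomp Require Import boolp classical_sets.
From mathcomp Require Import zify.

Import Order.TTheory GRing.Theory Num.Theory.

Local Open Scope classical_set_scope.
Local Open Scope ring_scope.

Definition l1dist {n} (x y : Zpt n) : int := \sum_k `|x k - y k|.

Lemma l1dist_ge0 {n} (x y : Zpt n) : 0 <= l1dist x y.
Proof. exact: sumr_ge0. Qed.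

Lemma l1distxx {n} (x : Zpt n) : l1dist x x = 0.
Proof. by apply: big1 => k _; rewrite subrr normr0. Qed.

Lemma l1dist_triangle {n} (y x z : Zpt n) :
  l1dist x z <= l1dist x y + l1dist y z.
Proof.
rewrite /l1dist -big_split; apply: ler_sum => k _ /=; exact: ler_distD.
Qed.

Lemma c1_adj_l1dist {n} {x y : Zpt n} : c1_adj x y -> l1dist x y = 1.
Proof.
case/existsP=> i /andP[/eqP xyi /forallP xyN].
rewrite /l1dist (bigD1 i) //= xyi big1 ?addr0 // => k ki.
by move/implyP: (xyN k) => /(_ ki) /eqP ->; rewrite subrr normr0.
Qed.

Lemma c1_adj_sym {n} (x y : Zpt n) : c1_adj x y = c1_adj y x.
Proof.
apply: eq_existsb => i; rewrite distrC; congr (_ && _).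
by apply: eq_forallb => j; rewrite [x j == _]eq_sym.
Qed.

(** While the path stays at [x] there is nothing to show; its first step to [y] is an adjacency. *)
Lemma path_pair_c1_adj {n} (x y : Zpt n) (p : seq (Zpt n)) :
  path c1_adj x p -> last x p = y -> (forall z, z \in p -> z = x \/ z = y) ->
  x = y \/ c1_adj x y.
Proof.
elim: p => [_ /= -> _|z p IH /= /andP[xz zp] zpy pP]; first by left.
case: (pP z (mem_head _ _)) => zE; rewrite {}zE in xz zp zpy; last by right.
by apply: IH => // t tp; apply: pP; rewrite inE tp orbT.
Qed.

Lemma c1_connected_pair {n} (x y : Zpt n) :
  c1_adj x y -> c1_connected [set x; y].
Proof.
move=> xy s t [] -> [] ->.
- by exists [::].
- exists [:: y]; split=> //= [|z]; first by rewrite xy.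
  by rewrite inE => /eqP ->; right.
- exists [:: x]; split=> //= [|z]; first by rewrite c1_adj_sym xy.
  by rewrite inE => /eqP ->; left.
- by exists [::].
Qed.

(** The pair [[set u; v]] is connected, hence so is its image, which has no points besides [g u] and
    [g v]. *)
Lemma c1_continuous_adj {n} {X : set (Zpt n)} {g : X -> X} {u v : X} :
  c1_continuous g -> c1_adj (val u) (val v) ->
  val (g u) = val (g v) \/ c1_adj (val (g u)) (val (g v)).
Proof.
move=> gC uv; have := gC [set u; v].
rewrite !image_setU !image_set1.
move=> /(_ (c1_connected_pair _ _ uv)) /(_ (val (g u)) (val (g v))).
by case; [left|right|move=> p [pP pl pS]; apply: path_pair_c1_adj pP pl pS].
Qed.

Lemma box_step {n} {a b : 'I_n -> int} {x c : Zpt n} :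
  box a b x -> box a b c -> x <> c ->
  exists y : Zpt n,
    [/\ box a b y, c1_adj x y & l1dist x c = 1 + l1dist y c].
Proof.
move=> xB cB xc.
have [j xcj] : exists j, x j != c j.
  apply/existsP; apply: contra_notT xc; rewrite negb_exists => /forallP xcE.
  by apply/ffunP => j; apply/eqP; rewrite -[_ == _]negbK xcE.
(* One unit step towards [c] in a coordinate where [x] and [c] differ stays between them, hence in
   the box. *)
pose y : Zpt n := [ffun k => if k == j then
  (if x j < c j then x j + 1 else x j - 1) else x k].
have yj : y j = if x j < c j then x j + 1 else x j - 1 by rewrite ffunE eqxx.
have yN k : k != j -> y k = x k by rewrite ffunE => /negPf ->.
exists y; split.
- move=> k; case: (eqVneq k j) => [->|/yN ->]; last exact: xB.
  by rewrite yj; have := xB j; have := cB j; case: ifP => ?; lia.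
- apply/existsP; exists j; rewrite yj; apply/andP; split.
    by case: ifP => _; lia.
  by apply/forallP => k; apply/implyP => /yN ->.
- rewrite /l1dist (bigD1 j) //= [in RHS](bigD1 j) //= addrA.
  congr (_ + _); first by rewrite yj; case: ifP => ?; lia.
  by apply: eq_bigr => k /yN ->.
Qed.

Lemma c1_continuous_l1dist_box {n} {X : set (Zpt n)} {g : X -> X}
    {a b : 'I_n -> int} {u w : X} :
  c1_continuous g -> box a b `<=` X -> box a b (val u) -> box a b (val w) ->
  l1dist (val (g u)) (val (g w)) <= l1dist (val u) (val w).
Proof.
move=> gC BX uB wB.
(* Induction on the length of a geodesic from [u] to [w] in the box, with [w] fixed; [g] maps each
   unit step to a step of length at most 1. *)
have [N] := ubnP `|l1dist (val u) (val w)|%N.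
elim: N u uB => // N IH u uB uwN.
case: (pselect (val u = val w)) => [/val_inj ->|uw]; first by rewrite !l1distxx.
have [y [yB uy duw]] := box_step uB wB uw.
pose v : X := exist _ y (mem_set (BX _ yB)).
have dguv : l1dist (val (g u)) (val (g v)) <= 1.
  by case: (c1_continuous_adj (v := v) gC uy) => [->|/c1_adj_l1dist ->];
    rewrite ?l1distxx.
have dvw : l1dist (val (g v)) (val (g w)) <= l1dist (val v) (val w).
  apply: IH => //; rewrite -[l1dist (val v) _]/(l1dist y (val w)).
  by have := l1dist_ge0 y (val w); lia.
rewrite duw; apply: le_trans (l1dist_triangle (val (g v)) _ _) _.
exact: lerD.
Qed.

(** Add the two distance bounds. Off [j], [x] lies between [c] and [d], so by the triangle
    inequality its terms are at most those of [y]; what remains is twice the claim. *)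
Lemma coord_dist_le {n} {x y c d : Zpt n} (j : 'I_n) :
  c j = d j -> (forall k, k != j -> `|x k - c k| + `|x k - d k| = `|c k - d k|) ->
  l1dist y c <= l1dist x c -> l1dist y d <= l1dist x d ->
  `|y j - c j| <= `|x j - c j|.
Proof.
move=> cdj xcd yc yd.
have := lerD yc yd; rewrite /l1dist -!big_split /=.
rewrite (bigD1 j) //= [in leRHS](bigD1 j) //= -cdj.
suff : \sum_(k | k != j) (`|x k - c k| + `|x k - d k|) <=
       \sum_(k | k != j) (`|y k - c k| + `|y k - d k|).
  by move: (\sum_(k | _) _) (\sum_(k | _) _) => s t; lia.
by apply: ler_sum => k /xcd ->; lia.
Qed.

Lemma box_corners_sub {n} {a b : 'I_n -> int} :
  (forall j, a j <= b j) -> box_corners a b `<=` box a b.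
Proof. by move=> ab x xC j; have := ab j; case: (xC j) => ->; lia. Qed.

Lemma box_eq_of_corner_dist {n} {a b : 'I_n -> int} {x y : Zpt n} :
  box a b x ->
  (forall c, box_corners a b c -> l1dist y c <= l1dist x c) -> y = x.
Proof.
move=> xB yx; apply/ffunP => j.
pose corner (e : 'I_n -> int) (f : 'I_n -> int) : Zpt n :=
  [ffun k => if k == j then e k else f k].
have face (e : 'I_n -> int) :
    (forall k, e k = a k \/ e k = b k) -> `|y j - e j| <= `|x j - e j|.
  move=> eC.
  have cj f : corner e f j = e j by rewrite ffunE eqxx.
  have cN f k : k != j -> corner e f k = f k by rewrite ffunE => /negPf ->.
  have cC f : (forall k, f k = a k \/ f k = b k) ->
      box_corners a b (corner e f).
    by move=> fC k; rewrite ffunE; case: ifP.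
  (* [corner e a] and [corner e b] agree at [j] and are opposite corners of the face [e j]. *)
  rewrite -(cj a); apply: (coord_dist_le (d := corner e b)).
  - by rewrite !cj.
  - by move=> k kj; rewrite !cN //; have := xB k; lia.
  - by apply/yx/cC; left.
  - by apply/yx/cC; right.
(* Being no farther from [p] gives [s <= t]; being no farther from [q] gives [t <= s]. *)
have squeeze (s t p q : int) :
  p <= t <= q -> `|s - p| <= `|t - p| -> `|s - q| <= `|t - q| -> s = t by lia.
apply: squeeze (xB j) _ _; first by apply: face; left.
by apply: face; right.
Qed.

Theorem theorem5p1 (n m : nat) (hn : (1 <= n)%N) (hm : (1 <= m)%N)
    (a b : 'I_m -> 'I_n -> int) (hab : forall i j, a i j <= b i j) :
  let X := \bigcup_i box (a i) (b i) in
  let A := \bigcup_i box_corners (a i) (b i) in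
  c1_connected X -> freezing_set X A.
Proof.
move=> X A _; split=> [x [i _ xC]|g gC AF].
  by exists i => //; apply: box_corners_sub xC.
apply/funext => u; apply: val_inj.
have [i _ uB] := set_mem (valP u).
apply: (box_eq_of_corner_dist uB) => c cC.
(* [w] is the corner [c] seen as a point of [X], fixed by [g]. *)
have [|w gw wc] := AF c; first by exists i.
rewrite -{c}wc in cC *.
have BX : box (a i) (b i) `<=` X by move=> x xB; exists i.
have wB : box (a i) (b i) (val w) by apply: box_corners_sub cC.
by have := c1_continuous_l1dist_box gC BX uB wB; rewrite gw.
Qed.
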